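(* Let $K$ be a compact metric space, $\Phi=\{\varphi_1,\dots,\varphi_n\}$ a system of linearly independent functions in $C(K)$, $\mathcal{P}$ the space of polynomials by the system $\Phi$, $L=\{\ell_j\}_{j=1}^r$, $r<n$, a set of linearly independent linear functionals on $\mathcal{P}$, $b_1,\dots,b_r\in\mathbb{R}$, and $f\in C(K)$. A polynomial $p\in\mathcal{P}$ satisfying $\ell_j(p)=b_j$, $j=1,\dots,r$, is a polynomial of best approximation for $f$ under the constraints $\ell_j(p)=b_j$, $j=1,\dots,r$ (that is, $\|p-f\|\le\|q-f\|$ for all $q\in\mathcal{P}$ with $\ell_j(q)=b_j$, $j=1,\dots,r$) if and only if $p$ has an $L$-alternance.
   Context: $C(K)$ is the space of continuous real functions on $K$ with the uniform norm $\|g\|=\max_{t\in K}|g(t)|$. A polynomial by the system $\Phi$ is a linear combination $p=\sum_{k=1}^n p^k\varphi_k$, $p^k\in\mathbb{R}$, with coefficient vector $\boldsymbol{p}=(p^1,\dots,p^n)\in\mathbb{R}^n$; $\mathcal{P}$ is the linear space of all of them, identified with $\mathbb{R}^n$. The moment vector is $\boldsymbol{u}(t)=(\varphi_1(t),\dots,\varphi_n(t))^T\in\mathbb{R}^n$. Each $\ell_j$ is associated with the vector $\boldsymbol{\ell}_j\in\mathbb{R}^n$ such that $\ell_j(p)=(\boldsymbol{\ell}_j,\boldsymbol{p})$ (Euclidean inner product), and $L^\perp\subset\mathbb{R}^n$ is the orthogonal complement of $\boldsymbol{\ell}_1,\dots,\boldsymbol{\ell}_r$, so $\dim L^\perp=n-r$.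 Projection means orthogonal projection. $L$-alternance: given $f$, a polynomial $p\in\mathcal{P}$ has an $L$-alternance $\{\tau_1,\dots,\tau_m\}$, where $\tau_i\in K$ and $1\le m\le n-r+1$, if there are signs $\sigma_1,\dots,\sigma_m\in\{-1,1\}$ such that (1) $p(\tau_i)-f(\tau_i)=\sigma_i\|p-f\|$ for $i=1,\dots,m$; and (2) the convex hull of the orthogonal projections of the vectors $\{\sigma_i\boldsymbol{u}(\tau_i)\}_{i=1}^m$ onto $L^\perp$ contains the origin. The points are given as an indexed list; they are not required to be distinct. *)

(* Defs.v *)
From HB Require Import structures.
From mathcomp Require Import all_boot all_order all_algebra.
From mathcomp Require Import all_classical all_reals all_analysis.

Set Implicit Arguments.
Unset Strict Implicit.
Unset Printing Implicit Defensive.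

Import Order.TTheory GRing.Theory Num.Theory.
Import numFieldNormedType.Exports.

Local Open Scope classical_set_scope.
Local Open Scope ring_scope.

Definition lin_indep (R : pzRingType) (V : lmodType R) (n : nat)
    (v : 'I_n -> V) : Prop :=
  forall c : 'I_n -> R, \sum_k c k *: v k = 0 -> forall k, c k = 0.

Definition conv_hull (R : numDomainType) (V : lmodType R) (A : set V) : set V :=
  smallest (@convex_set R V) A.

Section Orthogonality.
Context {R : realFieldType}.

(* Subspaces of R^n are row spaces of matrices, and matrices act on row
   vectors from the right. *)
Definition ortho_compl (m n : nat) (A : 'M[R]_(m, n)) : 'M[R]_n :=
  orthomx idfun 1%:M A.

(* u *m ortho_proj A is the orthogonal projection of u onto the row space of A;
   see ortho_proj_sub and ortho_proj_compl_sub. *)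
Definition ortho_proj (m n : nat) (A : 'M[R]_(m, n)) : 'M[R]_n :=
  proj_mx <<A>>%MS (ortho_compl A).

Lemma ortho_complP m n (A : 'M[R]_(m, n)) (u : 'rV[R]_n) :
  reflect (forall i, \sum_k A i k * u 0 k = 0) (u <= ortho_compl A)%MS.
Proof.
have E i : (u *m A^T) 0 i = \sum_k A i k * u 0 k.
  by rewrite mxE; apply: eq_bigr => k _; rewrite mxE mulrC.
apply: (iffP sub_kermxP); rewrite mul1mx map_mx_id // => H.
- by move=> i; rewrite -E H mxE.
- by apply/rowP => i; rewrite E H mxE.
Qed.

Lemma ortho_compl_disj m n (A : 'M[R]_(m, n)) :
  (<<A>> :&: ortho_compl A)%MS = 0.
Proof.
apply/eqP/rowV0Pn => -[v]; rewrite sub_capmx genmxE => /andP[/submxP[w vE] vo].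
apply/negP; rewrite negbK.
have vv : v *m v^T = 0.
  move/sub_kermxP: vo; rewrite mul1mx map_mx_id // => vA.
  by rewrite {2}vE trmx_mul mulmxA vA mul0mx.
have : \sum_k v 0 k ^+ 2 = 0.
  have := congr1 (fun B : 'M[R]_1 => B 0 0) vv; rewrite !mxE => vv0.
  rewrite -[RHS]vv0.
  by apply: eq_bigr => k _; rewrite mxE expr2.
move/eqP; rewrite psumr_eq0 => [|k _]; last exact: sqr_ge0.
move=> /allP h; apply/eqP/rowP => k; rewrite mxE; apply/eqP.
by rewrite -sqrf_eq0; exact: (h k (mem_index_enum k)).
Qed.

Lemma addsmx_ortho_compl m n (A : 'M[R]_(m, n)) :
  (<<A>> + ortho_compl A :=: 1%:M)%MS.
Proof.
apply/eqmxP/andP; rewrite submx1; split=> //.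
rewrite -mxrank_leqif_sup ?submx1 // mxrank1.
rewrite (mxdirectP _) /=; last first.
  by rewrite mxdirect_addsE /= !mxdirectE /= ortho_compl_disj !eqxx.
rewrite genmxE mxrank_ker mul1mx mxrank_map mxrank_tr.
by rewrite subnKC ?rank_leq_col.
Qed.

Lemma ortho_proj_sub m n (A : 'M[R]_(m, n)) (u : 'rV[R]_n) :
  (u *m ortho_proj A <= A)%MS.
Proof. by rewrite (submx_trans (proj_mx_sub _ _ _)) // genmxE. Qed.

Lemma ortho_proj_compl_sub m n (A : 'M[R]_(m, n)) (u : 'rV[R]_n) :
  (u - u *m ortho_proj A <= ortho_compl A)%MS.
Proof. by rewrite proj_mx_compl_sub // addsmx_ortho_compl submx1. Qed.

End Orthogonality.

Section UniformNorm.
Context {R : realType} {K : topologicalType}.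

(* The maximum of |g| when K is compact and nonempty and g is continuous; see
   unorm_max. *)
Definition unorm (g : K -> R) : R := sup [set `|g t| | t in [set: K]].

Lemma unorm_max (g : K -> R) :
  [set: K] !=set0 -> compact [set: K] -> continuous g ->
  (exists t, `|g t| = unorm g) /\ (forall t, `|g t| <= unorm g).
Proof.
move=> K0 cK cg.
have cng : {within [set: K], continuous (fun t => `|g t|)}.
  apply: continuous_subspaceT => t.
  by apply: (@cvg_comp _ _ _ g (fun y : R => `|y|)); [exact: cg|exact: norm_continuous].
have [c _ cmax] := compact_EVT_max K0 cK cng.
have max t : `|g t| <= `|g c| by apply: cmax; exact: mem_set.
suff E : `|g c| = unorm g by split; [exists c | move=> t; rewrite -E].
apply/eqP; rewrite eq_le; apply/andP; split.
- apply: sup_upper_bound; last by exists c.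
  by split; [exists `|g c|; exists c | exists `|g c| => _ [t _ <-]].
- by apply: ge_sup; [exists `|g c|; exists c | move=> _ [t _ <-]].
Qed.

End UniformNorm.

Section Polynomials.
Context {R : realType} {K : Type} {n : nat} (phi : 'I_n -> K -> R).

Definition is_poly : {pred K -> R} :=
  fun g => `[< exists c : 'I_n -> R, g = \sum_k c k *: phi k >].

Lemma is_poly_submod_closed : submod_closed is_poly.
Proof.
split=> [|a g h]; rewrite !unfold_in.
  by apply/asboolP; exists (fun=> 0); rewrite big1 // => k _; rewrite scale0r.
move=> /asboolP[c ->] /asboolP[d ->]; apply/asboolP.
exists (fun k => a * c k + d k); rewrite scaler_sumr -big_split /=.
by apply: eq_bigr => k _; rewrite scalerDl scalerA.
Qed.

HB.instance Definition _ :=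
  GRing.isSubmodClosed.Build R (K -> R) is_poly is_poly_submod_closed.

Record polySpace := PolySpace { poly_fun :> K -> R; _ : poly_fun \in is_poly }.

HB.instance Definition _ := [isSub for poly_fun].
HB.instance Definition _ := [Choice of polySpace by <:].
HB.instance Definition _ := [SubChoice_isSubLmodule of polySpace by <:].

Lemma is_poly_basis (k : 'I_n) : phi k \in is_poly.
Proof.
rewrite unfold_in; apply/asboolP; exists (fun j => (j == k)%:R).
rewrite (bigD1 k) //= eqxx scale1r big1 ?addr0 // => j /negbTE ->.
by rewrite scale0r.
Qed.

Definition poly_basis (k : 'I_n) : polySpace := PolySpace (is_poly_basis k).

Definition poly_of (c : 'rV[R]_n) : polySpace := \sum_k c 0 k *: poly_basis k.

Definition moment (t : K) : 'rV[R]_n := \row_k phi k t.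

(* Row j is the vector representing the j-th functional in the coordinates of
   the system phi; see ell_mxE. *)
Definition ell_mx (r : nat) (ell : 'I_r -> {scalar polySpace}) : 'M[R]_(r, n) :=
  \matrix_(j < r, k < n) ell j (poly_basis k).

Lemma poly_ofE (c : 'rV[R]_n) (t : K) :
  poly_of c t = \sum_k c 0 k * phi k t.
Proof.
have -> : poly_fun (poly_of c) = \sum_k c 0 k *: phi k.
  rewrite -[LHS]/(val (poly_of c)) raddf_sum.
  by apply: eq_bigr => k _; exact: (GRing.valZ (c 0 k) (poly_basis k)).
by rewrite fct_sumE.
Qed.

Lemma poly_of_surj (p : polySpace) : exists c : 'rV[R]_n, p = poly_of c.
Proof.
case: p => g gP; have := gP; rewrite unfold_in => /asboolP[c gE].
exists (\row_k c k); apply: val_inj => /=; rewrite gE.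
apply/funext => t; rewrite poly_ofE fct_sumE.
by apply: eq_bigr => k _; rewrite mxE.
Qed.

Lemma ell_mxE r (ell : 'I_r -> {scalar polySpace}) (j : 'I_r) (c : 'rV[R]_n) :
  ell j (poly_of c) = \sum_k ell_mx ell j k * c 0 k.
Proof.
rewrite linear_sum; apply: eq_bigr => k _.
by rewrite linearZ mxE mulrC.
Qed.

End Polynomials.

Section Approximation.
Context {R : realType} {K : topologicalType} {n r : nat}.
Context {phi : 'I_n -> K -> R} (ell : 'I_r -> {scalar polySpace phi}).

Definition feasible (b : 'I_r -> R) (p : polySpace phi) : Prop :=
  forall j, ell j p = b j.

Definition best_approximation (b : 'I_r -> R) (f : K -> R)
    (p : polySpace phi) : Prop :=
  forall q : polySpace phi, feasible b q ->
    unorm (fun t => p t - f t) <= unorm (fun t => q t - f t).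

(* ortho_compl (ell_mx ell) is the orthogonal complement of the vectors
   representing the functionals.  The points tau i may repeat. *)
Definition is_L_alternance (f : K -> R) (p : polySpace phi) (m : nat)
    (tau : 'I_m -> K) : Prop :=
  (1 <= m <= n - r + 1)%N /\
  exists sigma : 'I_m -> R,
    [/\ forall i, sigma i = -1 \/ sigma i = 1,
        forall i, p (tau i) - f (tau i) =
                  sigma i * unorm (fun t => p t - f t) &
        conv_hull [set (sigma i *: moment phi (tau i))
                         *m ortho_proj (ortho_compl (ell_mx ell)) |
                   i in [set: 'I_m]] 0].

Definition has_L_alternance (f : K -> R) (p : polySpace phi) : Prop :=
  exists (m : nat) (tau : 'I_m -> K), is_L_alternance f p tau.

End Approximation.

(* Main.v *)
Require Import Defs.
From mathcomp Require Import all_boot all_order all_algebra.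
From mathcomp Require Import all_classical all_reals all_analysis.
From mathcomp Require Import ring lra.
Import Order.TTheory GRing.Theory Num.Theory.
Import numFieldNormedType.Exports.
Local Open Scope classical_set_scope.
Local Open Scope ring_scope.

Set Implicit Arguments.
Unset Strict Implicit.

(** The feasible polynomials are the translates of [p] by the polynomials whose
    coefficient vector [h] lies in [L^perp], and for such [h] the value at [t]
    of the polynomial is the inner product of [h] with the projection of the
    moment vector [u(t)] onto [L^perp].  So the theorem is a statement about
    the set of signed projected moments at the points where the error [p - f]
    is maximal in absolute value.

    If the hull of the projections at the points [tau_i] contains [0], no open
    half-space through the origin contains them all ([conv_hull0_ge0]): every
    admissible displacement [h] has the sign of the error, or vanishes, at some
    [tau_i], and does not decrease the norm there ([alternance_best]).

    Conversely, let [p] be optimal with error norm [M > 0], and let [E] be the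
    compact set where [|p - f| = M].  Among the convex combinations of
    [d + 1] signed projected moments over [E], [d = n - r = dim L^perp],
    compactness provides one, [v], of least Euclidean norm.  By Caratheodory's
    theorem mixing in one more point of [E] gives nothing new, so [v] is the
    point nearest to [0] even in the whole hull, whence [<a, v> >= <v, v>] for
    every signed projected moment [a] over [E] ([exists_nearest_point]).  If [v]
    were not [0], the polynomial with coefficients [v] would have strictly the
    sign of the error on all of [E], and subtracting a small multiple of it
    from [p] would bring the error below [M] at every point
    ([uniform_decrease]), against optimality.  So [v = 0], and the points that produce [v] form the
    alternance ([best_alternance]).  When [M = 0] there is no sign to respect,
    and one point taken with both signs is enough
    ([zero_error_alternance]). *)

(** * Convex combinations in finite dimension *)

(** Move along a linear relation [mu] between the vectors until the first
    coefficient vanishes: the step is the least of the ratios [l_i / mu_i]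
    with [mu_i > 0]. *)
Lemma conic_caratheodory (F : realFieldType) (m n : nat)
    (w : 'I_m -> 'rV[F]_n) (l : 'I_m -> F) :
  (\rank (\matrix_i w i) < m)%N -> (forall i, 0 <= l i) ->
  exists l' : 'I_m -> F, [/\ forall i, 0 <= l' i, exists i, l' i = 0 &
    \sum_i l' i *: w i = \sum_i l i *: w i].
Proof.
move=> rk l0.
(* A relation without positive coefficient is replaced by its opposite. *)
have [mu muw [j0 muj0]] : exists2 mu : 'I_m -> F,
    \sum_i mu i *: w i = 0 & exists i, 0 < mu i.
  have /rowV0Pn[u /sub_kermxP uw u0] : kermx (\matrix_i w i) != 0.
    by rewrite kermx_eq0 -row_leq_rank -ltnNge.
  have dep : \sum_i u 0 i *: w i = 0.
    rewrite -[RHS]uw mulmx_sum_row; apply: eq_bigr => i _; congr (_ *: _).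
    by apply/rowP => k; rewrite !mxE.
  have /rV0Pn[i ui] := u0.
  have [ui0|ui0] := ltP 0 (u 0 i).
    by exists (u 0) => //; exists i.
  exists (fun i => - u 0 i).
    under eq_bigr do rewrite scaleNr.
    by rewrite sumrN dep oppr0.
  by exists i; rewrite oppr_gt0 lt_neqAle ui.
have [i mui imin] := @arg_minP _ _ _ j0 (fun j => 0 < mu j)
  (fun j => l j / mu j) muj0.
exists (fun j => l j - l i / mu i * mu j); split.
- move=> j; rewrite subr_ge0.
  have [muj|muj] := ltP 0 (mu j).
    by rewrite -ler_pdivlMr // imin.
  apply: le_trans (l0 j).
  by rewrite mulr_ge0_le0 // divr_ge0 // ltW.
- by exists i; rewrite divfK ?subrr // gt_eqF.
- under eq_bigr do rewrite scalerBl -scalerA.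
  by rewrite sumrB -scaler_sumr muw scaler0 subr0.
Qed.

(** Appending a coordinate equal to [1] to every vector turns the condition on
    the sum of the weights into part of the vector equation, at the cost of
    one dimension. *)
Lemma caratheodory (F : realFieldType) (m n q : nat) (C : 'M[F]_(q, n))
    (w : 'I_m -> 'rV[F]_n) (l : 'I_m -> F) :
  (forall i, (w i <= C)%MS) -> ((\rank C).+1 < m)%N ->
  (forall i, 0 <= l i) -> \sum_i l i = 1 ->
  exists l' : 'I_m -> F, [/\ forall i, 0 <= l' i, \sum_i l' i = 1,
    exists i, l' i = 0 & \sum_i l' i *: w i = \sum_i l i *: w i].
Proof.
move=> wC rk l0 l1.
pose w1 i : 'rV_(n + 1) := row_mx (w i) 1%:M.
have sum_w1 (c : 'I_m -> F) :
    \sum_i c i *: w1 i = row_mx (\sum_i c i *: w i) (\sum_i c i)%:M.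
  have -> : (\sum_i c i)%:M = \sum_i c i *: (1%:M : 'M[F]_1).
    by rewrite raddf_sum; apply: eq_bigr => i _; rewrite scale_scalar_mx mulr1.
  elim/big_rec3: _ => [|i x y z _ ->]; first by rewrite row_mx0.
  by rewrite scale_row_mx add_row_mx.
have rk1 : (\rank (\matrix_i w1 i) < m)%N.
  apply: leq_trans rk; rewrite ltnS -[(\rank C).+1]addn1.
  have sub : (\matrix_i w1 i <= block_mx C 0 0 (1%:M : 'M[F]_1))%MS.
    apply/row_subP => i; rewrite rowK.
    have /submxP[D wD] := wC i.
    apply/submxP; exists (row_mx D 1%:M).
    by rewrite mul_row_block !mulmx0 addr0 add0r mulmx1 -wD.
  apply: leq_trans (mxrankS sub) _.
  by rewrite rank_diag_block_mx leq_add2l rank_leq_row.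
have [l' [l'0 l'z]] := conic_caratheodory rk1 l0.
rewrite !sum_w1 l1 => /eq_row_mx[Ew E1]; exists l'; split => //.
by have := congr1 (fun A : 'M[F]_1 => A 0 0) E1; rewrite !mxE.
Qed.

Definition dotv (R : comNzRingType) (n : nat) (u v : 'rV[R]_n) : R :=
  \sum_k u 0 k * v 0 k.

Lemma dotvC (R : comNzRingType) (n : nat) (u v : 'rV[R]_n) :
  dotv u v = dotv v u.
Proof. by apply: eq_bigr => k _; rewrite mulrC. Qed.

Lemma dotvDl (R : comNzRingType) (n : nat) (u v w : 'rV[R]_n) :
  dotv (u + v) w = dotv u w + dotv v w.
Proof. by rewrite -big_split; apply: eq_bigr => k _; rewrite mxE mulrDl. Qed.

Lemma dotvZl (R : comNzRingType) (n : nat) c (u w : 'rV[R]_n) :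
  dotv (c *: u) w = c * dotv u w.
Proof. by rewrite mulr_sumr; apply: eq_bigr => k _; rewrite mxE mulrA. Qed.

Lemma dotvv_ge0 (R : realFieldType) (n : nat) (u : 'rV[R]_n) : 0 <= dotv u u.
Proof. by apply: sumr_ge0 => k _; rewrite -expr2 sqr_ge0. Qed.

Lemma dotvv_gt0 (R : realFieldType) (n : nat) (u : 'rV[R]_n) :
  u != 0 -> 0 < dotv u u.
Proof.
move=> /rV0Pn[k uk]; rewrite /dotv (bigD1 k) //= ltr_wpDr //.
  by apply: sumr_ge0 => j _; rewrite -expr2 sqr_ge0.
by rewrite -expr2 exprn_even_gt0.
Qed.

(** First-order optimality: the squared norm along the segment from [v] to [w]
    has slope [2 (<w, v> - <v, v>)] at [v], so it would decrease near [v] if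
    this were negative. *)
Lemma nearest_dotv_ge (R : realFieldType) (n : nat) (v w : 'rV[R]_n) :
  (forall e, 0 <= e <= 1 ->
    dotv v v <= dotv ((1 - e) *: v + e *: w) ((1 - e) *: v + e *: w)) ->
  dotv v v <= dotv w v.
Proof.
move=> H; rewrite leNgt; apply/negP => lt.
set a := dotv v v in H lt; set x := dotv w v in lt.
set y := dotv w w.
have E e : dotv ((1 - e) *: v + e *: w) ((1 - e) *: v + e *: w) =
    (1 - e) ^+ 2 * a + 2 * (e * (1 - e)) * x + e ^+ 2 * y.
  rewrite dotvDl !dotvZl !(dotvC _ (_ + _)) !dotvDl !dotvZl.
  by rewrite (dotvC v w) -/a -/x -/y; ring.
pose D := a - x; pose B := a - 2 * x + y.
have D0 : 0 < D by rewrite subr_gt0.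
(* [B] is the squared norm of [v - w]. *)
have B0 : 0 <= B.
  have := dotvv_ge0 (v - w).
  rewrite -scaleN1r dotvDl dotvZl !(dotvC _ (_ + _)) !dotvDl !dotvZl.
  by rewrite (dotvC v w) -/a -/x -/y /B; lra.
have S0 : 0 < B + D by lra.
(* The squared norm drops by [e * (2 * D - e * B)], and this step has
   [e <= 1] and [e * B <= D]. *)
pose e := D / (B + D).
have e0 : 0 < e by rewrite divr_gt0.
have e1 : e <= 1 by rewrite ler_pdivrMr // mul1r; lra.
have := H e; rewrite (ltW e0) e1 => /(_ isT).
rewrite E.
have -> : (1 - e) ^+ 2 * a + 2 * (e * (1 - e)) * x + e ^+ 2 * y =
  a - e * (2 * D - e * B) by rewrite /D /B; ring.
have eB : e * B <= D by rewrite /e mulrAC ler_pdivrMr // ler_pM2l //; lra.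
rewrite leNgt => /negP; apply.
by rewrite ltrBlDr ltrDl mulr_gt0 //; lra.
Qed.

Lemma convex_set_sum (R : realFieldType) (V : lmodType R) (m : nat)
    (A : set V) (w : 'I_m -> V) (l : 'I_m -> R) :
  @convex_set R V A -> (forall i, A (w i)) ->
  (forall i, 0 <= l i) -> \sum_i l i = 1 -> A (\sum_i l i *: w i).
Proof.
elim: m w l => [|m IH] w l cA Aw l0.
  by rewrite big_ord0 => /eqP; rewrite eq_sym oner_eq0.
rewrite !big_ord_recl /=; set s := \sum_i l (lift ord0 i) => l1.
have s0 : 0 <= s by apply: sumr_ge0.
have [sz|sn0] := eqVneq s 0.
  move: l1; rewrite sz addr0 => ->; rewrite scale1r big1 ?addr0 // => i _.
  have /eqP := sz; rewrite /s psumr_eq0 // => /allP /(_ i (mem_index_enum i)).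
  by move=> /eqP ->; rewrite scale0r.
have Arest : A (\sum_i (l (lift ord0 i) / s) *: w (lift ord0 i)).
  apply: IH => //; last by rewrite -mulr_suml divff.
  by move=> i; rewrite divr_ge0.
have l01 : 0 <= l ord0 <= 1 by rewrite l0 -l1 lerDl.
have := cA (w ord0) _ (Itv01 (andP l01).1 (andP l01).2)
  (mem_set (Aw ord0)) (mem_set Arest).
move=> /set_mem; congr (A _).
rewrite /conv /=; congr (_ + _).
rewrite /unstable.onem -l1 addrAC subrr add0r scaler_sumr.
by apply: eq_bigr => i _; rewrite scalerA mulrC divfK.
Qed.

Lemma conv_hull_sum (R : realFieldType) (V : lmodType R) (m : nat)
    (w : 'I_m -> V) (l : 'I_m -> R) :
  (forall i, 0 <= l i) -> \sum_i l i = 1 ->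
  conv_hull [set w i | i in [set: 'I_m]] (\sum_i l i *: w i).
Proof.
move=> l0 l1 A [cA wA]; apply: convex_set_sum => // i.
by apply: wA; exists i.
Qed.

(** Otherwise the open half-space of the [v] with [<v, h> < 0] is a convex set
    that contains all the points but not [0]. *)
Lemma conv_hull0_ge0 (R : realFieldType) (n m : nat) (w : 'I_m -> 'rV[R]_n)
    (h : 'rV[R]_n) :
  conv_hull [set w i | i in [set: 'I_m]] 0 -> exists i, 0 <= dotv (w i) h.
Proof.
move=> hull0; apply: contrapT => /forallNP neg.
have : [set v : 'rV[R]_n | dotv v h < 0] 0.
  apply: hull0; split=> [x y e /set_mem xh /set_mem yh|_ [i _ <-] /=]; last first.
    by rewrite ltNge; apply/negP; exact: neg.
  apply: mem_set => /=; rewrite dotvDl !dotvZl.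
  have [e0 e1] : 0 <= e%:num /\ 0 <= unstable.onem e%:num.
    by split=> //; rewrite /unstable.onem subr_ge0.
  rewrite /= in xh yh.
  move: e0; rewrite le_eqVlt => /orP[/eqP <-|e0].
    by rewrite mul0r add0r /unstable.onem subr0 mul1r.
  have : e%:num * dotv x h < 0 by rewrite pmulr_rlt0.
  have : unstable.onem e%:num * dotv y h <= 0 by rewrite mulr_ge0_le0 // ltW.
  by lra.
suff : dotv 0 h = 0 by move=> /= ->; rewrite ltxx.
by apply: big1 => k _; rewrite mxE mul0r.
Qed.

(** * The point of a compact hull nearest to the origin *)

Lemma continuous_mul (R : realType) (T : topologicalType) (g h : T -> R) :
  continuous g -> continuous h -> continuous (fun t => g t * h t).
Proof. by move=> cg ch t; apply: cvgM; [exact: cg | exact: ch]. Qed.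

(** The points and weights of a convex combination of [m] vectors form a
    compact subset of a finite power of [K * R]. *)
Lemma exists_nearest_combination (R : realType) (K : topologicalType) (n m : nat)
    (E : set K) (a : K -> 'rV[R]_n) :
  E !=set0 -> compact E -> (forall k, continuous (fun t => a t 0 k)) ->
  (0 < m)%N ->
  exists (t : 'I_m -> K) (l : 'I_m -> R),
    [/\ forall i, E (t i), forall i, 0 <= l i, \sum_i l i = 1 &
      forall (t' : 'I_m -> K) (l' : 'I_m -> R),
        (forall i, E (t' i)) -> (forall i, 0 <= l' i) -> \sum_i l' i = 1 ->
        dotv (\sum_i l i *: a (t i)) (\sum_i l i *: a (t i)) <=
        dotv (\sum_i l' i *: a (t' i)) (\sum_i l' i *: a (t' i))].
Proof.
move=> [t0 Et0] cE ca m0.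
pose T : topologicalType := prod_topology (fun _ : 'I_m => (K * R)%type).
have cproj (i : 'I_m) : continuous (fun g : T => g i).
  exact: (@proj_continuous 'I_m (fun _ => (K * R)%type) i).
have c1 (i : 'I_m) : continuous (fun g : T => (g i).1).
  by move=> g; apply: (@cvg_comp _ _ _ _ fst); [exact: cproj | exact: cvg_fst].
have c2 (i : 'I_m) : continuous (fun g : T => (g i).2).
  by move=> g; apply: (@cvg_comp _ _ _ _ snd); [exact: cproj | exact: cvg_snd].
pose S : set T := [set g | forall i, E (g i).1 /\ `[0, 1]%classic (g i).2]
  `&` [set g | \sum_i (g i).2 = 1].
have cS : compact S.
  apply: compact_closedI.
    apply: (@tychonoff _ (fun _ : 'I_m => (K * R)%type)
      (fun _ => E `*` `[0, 1]%classic)) => i.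
    by apply: compact_setX => //; exact: segment_compact.
  apply: (@preimage_closed T R (fun g => \sum_i (g i).2) [set x | x = 1]);
    last exact: closed_eq.
  by move=> g _; apply: (continuous_big add_continuous) => i _; exact: c2.
pose comb (g : T) := \sum_i (g i).2 *: a (g i).1.
have cF : continuous (fun g : T => dotv (comb g) (comb g)).
  have ccomb k : continuous (fun g : T => comb g 0 k).
    have -> : (fun g : T => comb g 0 k) =
        (fun g : T => \sum_i (g i).2 * a (g i).1 0 k).
      by apply/funext => g; rewrite summxE; apply: eq_bigr => i _; rewrite mxE.
    apply: (continuous_big add_continuous) => i _.
    apply: continuous_mul; first exact: c2.
    by move=> g; apply: (@cvg_comp _ _ _ _ (fun t => a t 0 k)); [exact: c1 | exact: ca].
  apply: (continuous_big add_continuous) => k _.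
  by apply: continuous_mul; exact: ccomb.
have S0 : S !=set0.
  pose i0 := Ordinal m0.
  exists (fun i => (t0, (i == i0)%:R)); split => /=.
    by move=> i; split => //; rewrite in_itv /=; case: eqP; rewrite ?lexx ?ler01.
  by rewrite (bigD1 i0) //= big1 ?addr0 // => i /negbTE ->.
have [g /set_mem[gE g1] gmin] :=
  compact_EVT_min S0 cS (continuous_subspaceT cF).
exists (fun i => (g i).1), (fun i => (g i).2); split => //.
- by move=> i; case: (gE i).
- by move=> i; case: (gE i) => _; rewrite /= in_itv /= => /andP[].
move=> t' l' Et' l'0 l'1.
apply: (gmin (fun i => (t' i, l' i))); apply: mem_set; split => //= i.
split => //; rewrite in_itv /= l'0 /= -l'1 (bigD1 i) //= lerDl.
exact: sumr_ge0.
Qed.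

(** A combination of least norm among those with [d + 1] terms is of least norm
    also among those with [d + 2] terms, by Caratheodory, and these include
    the segments from it to the vectors [a s]. *)
Lemma exists_nearest_point (R : realType) (K : topologicalType) (n q d : nat)
    (E : set K) (a : K -> 'rV[R]_n) (C : 'M[R]_(q, n)) :
  E !=set0 -> compact E -> (forall k, continuous (fun t => a t 0 k)) ->
  (forall t, (a t <= C)%MS) -> (\rank C <= d)%N ->
  exists (t : 'I_d.+1 -> K) (l : 'I_d.+1 -> R),
    [/\ forall i, E (t i), forall i, 0 <= l i, \sum_i l i = 1 &
      let v := \sum_i l i *: a (t i) in forall s, E s -> dotv v v <= dotv (a s) v].
Proof.
move=> E0 cE ca aC rk.
have [t [l [Et l0 l1 lmin]]] := exists_nearest_combination E0 cE ca (ltn0Sn d).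
exists t, l; split => //= s Es; set v := \sum_i _.
apply: nearest_dotv_ge => e /andP[e0 e1].
(* Index [0] is the new point [s], with weight [e]. *)
pose ts (j : 'I_d.+2) := if unlift ord0 j is Some i then t i else s.
pose ls (j : 'I_d.+2) := if unlift ord0 j is Some i then (1 - e) * l i else e.
have Ets j : E (ts j) by rewrite /ts; case: unliftP.
have ls0 j : 0 <= ls j.
  by rewrite /ls; case: unliftP => // i _; rewrite mulr_ge0 ?subr_ge0.
have ls1 : \sum_j ls j = 1.
  rewrite big_ord_recl /ls unlift_none; under eq_bigr do rewrite liftK.
  by rewrite -mulr_sumr l1 mulr1 addrC subrK.
have lsE : \sum_j ls j *: a (ts j) = (1 - e) *: v + e *: a s.
  rewrite big_ord_recl /ls /ts unlift_none addrC; congr (_ + _).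
  rewrite scaler_sumr; apply: eq_bigr => i _; rewrite liftK.
  by rewrite scalerA.
have [l' [l'0 l'1 [i0 l'z] <-]] : exists l' : 'I_d.+2 -> R,
    [/\ forall i, 0 <= l' i, \sum_i l' i = 1, exists i, l' i = 0 &
    \sum_j l' j *: a (ts j) = (1 - e) *: v + e *: a s].
  by rewrite -lsE; apply: (caratheodory (C := C)).
have drop (V : zmodType) (F : 'I_d.+2 -> V) : F i0 = 0 ->
    \sum_j F j = \sum_i F (lift i0 i).
  by move=> Fz; rewrite (bigD1_ord i0) //= Fz add0r.
rewrite [X in _ <= dotv X X]drop ?l'z ?scale0r //.
by apply: lmin => //; rewrite -drop.
Qed.

(** * Decreasing a function that has the sign of a direction on its peak set *)

(** The maximum of [M - |g|] and [g h] is positive everywhere, hence at least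
    some [eta > 0] by compactness.  Where [|g| <= M - eta] a small step cannot
    reach [M]; where [g h >= eta] the square of [g - e h] decreases at first
    order in [e], uniformly. *)
Lemma uniform_decrease (R : realType) (K : topologicalType) (g h : K -> R) (M : R) :
  [set: K] !=set0 -> compact [set: K] -> continuous g -> continuous h ->
  (forall t, `|g t| <= M) -> (forall t, `|g t| = M -> 0 < g t * h t) ->
  exists e, forall t, `|g t - e * h t| < M.
Proof.
move=> K0 cK cg ch gM gh.
have cn (u : K -> R) : continuous u -> continuous (fun t => `|u t|).
  move=> cu t; apply: (@cvg_comp _ _ _ u (fun y : R => `|y|)); first exact: cu.
  exact: norm_continuous.
have [t1 hB] : exists t1, forall t, `|h t| <= `|h t1|.
  have [t1 _ t1P] := compact_EVT_max K0 cK (continuous_subspaceT (cn h ch)).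
  by exists t1 => t; apply: t1P; exact: mem_set.
have cG : continuous (fun t => Num.max (M - `|g t|) (g t * h t)).
  apply: (@max_fun_continuous _ K R (fun t => M - `|g t|) (fun t => g t * h t)).
    by move=> t; apply: cvgB; [exact: cvg_cst | exact: cn].
  exact: continuous_mul.
have [t2 _ t2P] := compact_EVT_min K0 cK (continuous_subspaceT cG).
set eta := Num.max _ _ in t2P.
have eta0 : 0 < eta.
  rewrite lt_max subr_gt0 lt_neqAle gM andbT.
  by have [/gh ->|] := eqVneq `|g t2| M; rewrite ?orbT.
have {t2P} etaP t : eta <= Num.max (M - `|g t|) (g t * h t).
  by apply: t2P; exact: mem_set.
pose B := `|h t1| + 1.
have B1 : 1 <= B by rewrite lerDr.
have B0 : 0 < B by lra.
have hlt t : `|h t| < B by rewrite ltr_pwDr // hB.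
(* [B >= 1], so [e * B] and [e * B ^+ 2] are both at most [eta]. *)
pose e := eta / B ^+ 2.
have e0 : 0 < e by rewrite divr_gt0 // exprn_gt0.
have eB2 : e * B ^+ 2 = eta by rewrite divfK // expf_neq0 // gt_eqF.
exists e => t; have := etaP t; rewrite le_max => /orP[far|dec].
  apply: le_lt_trans (ler_normB _ _) _; rewrite normrM (gtr0_norm e0).
  have eh : e * `|h t| < e * B by rewrite ltr_pM2l.
  have : e * B <= eta by rewrite -eB2 ler_pM2l // expr2 ler_peMl // ltW.
  by lra.
have M0 : 0 <= M by apply: le_trans (gM t).
rewrite -(@ltr_pXn2r _ 2) ?nnegrE // real_normK ?num_real //.
have gsq : g t ^+ 2 <= M ^+ 2 by rewrite -real_normK ?num_real // ler_pXn2r ?nnegrE.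
have hsq : h t ^+ 2 <= B ^+ 2.
  by rewrite -real_normK ?num_real // ler_pXn2r ?nnegrE // ltW.
have -> : (g t - e * h t) ^+ 2 = g t ^+ 2 - e * (2 * (g t * h t) - e * h t ^+ 2).
  by ring.
have eh : e * h t ^+ 2 <= eta by rewrite -eB2 ler_pM2l.
apply: lt_le_trans gsq; rewrite ltrBlDr ltrDl mulr_gt0 //; lra.
Qed.

(** * Polynomials under linear constraints *)

Lemma dotv_ortho_compl (R : realFieldType) (m n : nat) (A : 'M[R]_(m, n))
    (h u : 'rV[R]_n) :
  (h <= A)%MS -> (u <= ortho_compl A)%MS -> dotv h u = 0.
Proof.
move=> /submxP[D ->] /ortho_complP uA.
rewrite /dotv; under eq_bigr do rewrite mxE mulr_suml.
rewrite exchange_big big1 //= => i _.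
under eq_bigr do rewrite -mulrA.
by rewrite -mulr_sumr uA mulr0.
Qed.

(** The projection is self-adjoint and fixes [h]; here this reads that [u] and
    its projection differ by a vector orthogonal to [h]. *)
Lemma dotv_ortho_proj (R : realFieldType) (m n : nat) (A : 'M[R]_(m, n))
    (u h : 'rV[R]_n) :
  (h <= A)%MS -> dotv (u *m ortho_proj A) h = dotv u h.
Proof.
move=> hA; rewrite -[u in RHS](subrK (u *m ortho_proj A)) dotvDl.
have := dotv_ortho_compl hA (ortho_proj_compl_sub A u).
by rewrite dotvC => ->; rewrite add0r.
Qed.

Lemma poly_of_dotv (R : realType) (K : Type) (n : nat) (phi : 'I_n -> K -> R)
    (c : 'rV[R]_n) (t : K) :
  poly_of phi c t = dotv (moment phi t) c.
Proof.
by rewrite poly_ofE; apply: eq_bigr => k _; rewrite mxE mulrC.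
Qed.

Lemma poly_continuous (R : realType) (K : topologicalType) (n : nat)
    (phi : 'I_n -> K -> R) (p : polySpace phi) :
  (forall k, continuous (phi k)) -> continuous (p : K -> R).
Proof.
move=> cphi; have [c ->] := poly_of_surj p.
have -> : (poly_of phi c : K -> R) = fun t => \sum_k c 0 k * phi k t.
  by apply/funext => t; rewrite poly_ofE.
apply: (continuous_big add_continuous) => k _.
by apply: continuous_mul => // t; exact: cvg_cst.
Qed.

Section Constraints.
Context {R : realType} {K : Type} {n r : nat} {phi : 'I_n -> K -> R}.
Implicit Type ell : 'I_r -> {scalar polySpace phi}.

(** The directions [c] that keep the constraints are the vectors of
    [L^perp]. *)
Lemma ell_vanishP ell (c : 'rV[R]_n) :
  (forall j, ell j (poly_of phi c) = 0) <->
  (c <= ortho_compl (ell_mx ell))%MS.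
Proof.
split=> [H|/ortho_complP H j]; last by rewrite ell_mxE.
by apply/ortho_complP => j; rewrite -ell_mxE.
Qed.

Lemma ell_mx_rank ell :
  lin_indep (fun j => (ell j : polySpace phi -> R)) -> \rank (ell_mx ell) = r.
Proof.
move=> indep; apply/eqP; rewrite -[_ == _]/(row_free _) -kermx_eq0.
apply/rowV0P => w /sub_kermxP wE.
have z : \sum_j w 0 j *: (ell j : polySpace phi -> R) = 0.
  apply/funext => q; have [c ->] := poly_of_surj q.
  rewrite fct_sumE.
  transitivity (dotv (w *m ell_mx ell) c); last first.
    by rewrite wE; apply: big1 => k _; rewrite mxE mul0r.
  rewrite /dotv; under [RHS]eq_bigr do rewrite mxE mulr_suml.
  rewrite exchange_big /=; apply: eq_bigr => j _.
  rewrite -[LHS]/(w 0 j * ell j (poly_of phi c)) ell_mxE mulr_sumr.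
  by apply: eq_bigr => k _; rewrite mulrA.
by apply/rowP => j; rewrite mxE (indep _ z).
Qed.

(** Together with Caratheodory's theorem this is the source of the bound
    [n - r + 1] on the number of points. *)
Lemma rank_ortho_compl_ell ell :
  lin_indep (fun j => (ell j : polySpace phi -> R)) ->
  \rank (ortho_compl (ell_mx ell)) = (n - r)%N.
Proof.
by move=> indep; rewrite mxrank_ker mul1mx mxrank_map mxrank_tr ell_mx_rank.
Qed.

End Constraints.

(** * Best approximation and alternance *)

Section Alternance.
Context {R : realType} {K : topologicalType} {n r : nat}.
Context {phi : 'I_n -> K -> R} {ell : 'I_r -> {scalar polySpace phi}}.
Context {f : K -> R} {b : 'I_r -> R} {p : polySpace phi}.
Hypotheses (cK : compact [set: K]) (phi_cont : forall k, continuous (phi k)).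
Hypotheses (f_cont : continuous f) (hp : feasible ell b p).

Lemma error_continuous (q : polySpace phi) : continuous (fun t => q t - f t).
Proof.
move=> t; apply: cvgB; last exact: f_cont.
exact: poly_continuous.
Qed.

(** Let [q - p] have coefficient vector [c].  The signed projected
    moments do not all have negative inner product with [c], so
    [sigma_i (q - p)] is nonnegative at some [tau_i], where [|q - f|] is then
    at least [sigma_i (p - f) = ||p - f||]. *)
Lemma alternance_best : has_L_alternance ell f p -> best_approximation ell b f p.
Proof.
move=> [m [tau [/andP[m0 _] [sigma [sgn ptau hull]]]]] q hq.
have K0 : [set: K] !=set0 by exists (tau (Ordinal m0)).
have [_ qmax] := unorm_max K0 cK (error_continuous (q := q)).
have [c cE] := poly_of_surj (q - p).
have cC : (c <= ortho_compl (ell_mx ell))%MS.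
  by apply/ell_vanishP => j; rewrite -cE linearB /= hq hp subrr.
have cval t : poly_of phi c t = q t - p t.
  by rewrite -cE -[poly_fun _]/(val (q - p)) raddfB.
have [i] := conv_hull0_ge0 c hull.
rewrite dotv_ortho_proj // dotvZl -poly_of_dotv cval => si.
apply: le_trans (qmax (tau i)).
have E : q (tau i) - f (tau i) =
    (q (tau i) - p (tau i)) + sigma i * unorm (fun t => p t - f t).
  by rewrite -ptau addrA subrK.
case: (sgn i) => s; rewrite E s in si *.
  by rewrite -normrN; apply: le_trans (ler_norm _); lra.
by apply: le_trans (ler_norm _); lra.
Qed.

(** With opposite signs at one point, [0] is the midpoint of the two signed
    vectors; two points are allowed because [r < n]. *)
Lemma zero_error_alternance : [set: K] !=set0 -> (r < n)%N ->
  unorm (fun t => p t - f t) = 0 -> has_L_alternance ell f p.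
Proof.
move=> K0 hr M0; have [t0 _] := K0.
have [_ pmax] := unorm_max K0 cK (error_continuous (q := p)).
exists 2%N, (fun=> t0); split.
  by rewrite /= addn1 ltnS subn_gt0.
exists (fun i => (-1) ^+ (i : nat)); split.
- by move=> i; rewrite -signr_odd; case: odd; [left|right].
- move=> i; rewrite M0 mulr0; apply/eqP.
  by rewrite -normr_le0 -M0.
pose u i := ((-1) ^+ (i : nat) *: moment phi t0) *m
  ortho_proj (ortho_compl (ell_mx ell)).
have <- : \sum_(i < 2) (2^-1 : R) *: u i = 0.
  by rewrite !big_ord_recl big_ord0 addr0 /u -scalerDr -mulmxDl -scalerDl
    subrr scale0r mul0mx scaler0.
apply: conv_hull_sum; first by move=> i; rewrite invr_ge0.
by rewrite !big_ord_recl big_ord0; lra.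
Qed.

(** The nearest point [v] serves twice: [v = 0] is the hull condition, and
    [v != 0] is the coefficient vector of a direction of improvement. *)
Lemma best_alternance :
  [set: K] !=set0 -> lin_indep (fun j => (ell j : polySpace phi -> R)) ->
  0 < unorm (fun t => p t - f t) ->
  best_approximation ell b f p -> has_L_alternance ell f p.
Proof.
move=> K0 indep; set M := unorm _ => M0 best.
pose g t := p t - f t.
have cg : continuous g := error_continuous (q := p).
have [[t0 t0M] gM] := unorm_max K0 cK cg.
pose C := ortho_compl (ell_mx ell).
pose E := [set t | `|g t| = M].
have cE : compact E.
  apply: subclosed_compact cK _ => //.
  apply: (@preimage_closed K R (fun t => `|g t|) [set x | x = M]);
    last exact: closed_eq.
  move=> t _; apply: (@cvg_comp _ _ _ g (fun y : R => `|y|)); first exact: cg.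
  exact: norm_continuous.
(* On [E] the quotient [g t / M] is the sign of the error; unlike the sign it is
   continuous on the whole space. *)
pose a t := (g t / M *: moment phi t) *m ortho_proj C.
have ca k : continuous (fun t => a t 0 k).
  have -> : (fun t => a t 0 k) =
      fun t => \sum_j g t / M * phi j t * ortho_proj C j k.
    by apply/funext => t; rewrite mxE; apply: eq_bigr => j _; rewrite !mxE.
  apply: (continuous_big add_continuous) => j _.
  apply: continuous_mul; last by move=> t; exact: cvg_cst.
  apply: continuous_mul => //; apply: continuous_mul => // t; exact: cvg_cst.
have rkC : (\rank C <= n - r)%N by rewrite rank_ortho_compl_ell.
have [tau [l [Etau l0 l1]]] := exists_nearest_point
  (ex_intro _ t0 t0M : E !=set0) cE ca (fun t => ortho_proj_sub _ _) rkC.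
set v := \sum_i _ => /= vmin.
have [v0|vN0] := eqVneq v 0.
  exists (n - r).+1, tau; split; first by rewrite addn1 leqnn.
  exists (fun i => g (tau i) / M); split.
  - move=> i; have := Etau i; rewrite /E /=.
    have [g0|g0] := ler0P (g (tau i)) => gE; [left|right].
      by rewrite -[g _]opprK gE mulNr divff // gt_eqF.
    by rewrite gE divff // gt_eqF.
  - by move=> i; rewrite divfK // gt_eqF.
  - by rewrite -v0; exact: conv_hull_sum.
have vC : (v <= C)%MS.
  by apply: summx_sub => i _; rewrite scalemx_sub // ortho_proj_sub.
have vv : 0 < dotv v v := dotvv_gt0 vN0.
have dec t : `|g t| = M -> 0 < g t * poly_of phi v t.
  move=> /vmin /(lt_le_trans vv).
  rewrite dotv_ortho_proj // dotvZl -poly_of_dotv mulrAC.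
  by rewrite pmulr_lgt0 ?invr_gt0.
have cv : continuous (poly_of phi v : K -> R) by exact: poly_continuous.
have [e better] := uniform_decrease K0 cK cg cv gM dec.
pose q := p - e *: poly_of phi v.
have qE t : q t = p t - e * poly_of phi v t.
  transitivity (val p t - val (e *: poly_of phi v) t).
    by rewrite -[poly_fun q]/(val (p - e *: poly_of phi v)) raddfB.
  by rewrite (GRing.valZ e (poly_of phi v)).
have hq : feasible ell b q.
  move=> j; rewrite /q linearB linearZ /= hp.
  by rewrite (ell_vanishP ell v).2 // mulr0 subr0.
have [[t1 t1M] _] := unorm_max K0 cK (error_continuous (q := q)).
have := best q hq; rewrite -t1M qE leNgt => /negP[].
by rewrite addrAC; exact: better.
Qed.

End Alternance.

Unset Implicit Arguments.
Set Strict Implicit.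

Theorem theorem6 (R : realType) (K : metricType R)
    (hK : compact [set: K])
    (n : nat) (phi : 'I_n -> K -> R)
    (phi_cont : forall k, continuous (phi k))
    (phi_indep : lin_indep phi)
    (r : nat) (hr : (r < n)%N)
    (ell : 'I_r -> {scalar polySpace phi})
    (ell_indep : lin_indep (fun j => (ell j : polySpace phi -> R)))
    (b : 'I_r -> R)
    (f : K -> R) (f_cont : continuous f)
    (p : polySpace phi) (hp : feasible ell b p) :
  best_approximation ell b f p <-> has_L_alternance ell f p.
Proof.
split; last exact: alternance_best.
(* On an empty space every function is [0], which independence excludes
   for [n > 0]. *)
have K0 : [set: K] !=set0.
  apply/set0P/negP => /eqP Kempty.
  have z : \sum_k (1 : R) *: phi k = 0.
    apply/funext => t; suff : set0 t by [].
    by rewrite -Kempty.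
  have /eqP := phi_indep _ z (Ordinal hr).
  by rewrite oner_eq0.
have [M0|MN0] := eqVneq (unorm (fun t => p t - f t)) 0.
  by move=> _; apply: zero_error_alternance.
apply: best_alternance => //; rewrite lt_neqAle eq_sym MN0 /=.
have [[t <-] _] := unorm_max K0 hK (error_continuous phi_cont f_cont (q := p)).
exact: normr_ge0.
Qed.
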